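(* Let $X$ be a real Hilbert space, let $\Gamma\subseteq\mathbb{R}_{++}$, and let $A,B$ be maximally monotone operators on $X$ such that $Z:=\operatorname{zer}(A+B)\neq\varnothing$. Let $(\gamma_n)_{n\in\mathbb{N}}$ be a sequence in $\Gamma$ that converges to some $\overline{\gamma}\in\Gamma$ and satisfies $\sum_{n\in\mathbb{N}}(\gamma_{n+1}-\gamma_n)_+<+\infty$. Given $x_0\in X$, set $z_0=J_{\gamma_0A}x_0$ and, for $n=0,1,2,\dots$, define $$\begin{cases} y_n=J_{\gamma_nB}(2z_n-x_n),\\ w_n=x_n-z_n+y_n,\\ z_{n+1}=J_{\gamma_nA}w_n,\\ x_{n+1}=\dfrac{\gamma_{n+1}}{\gamma_n}w_n+\Bigl(1-\dfrac{\gamma_{n+1}}{\gamma_n}\Bigr)z_{n+1}.\end{cases}$$ Then $(x_n)_{n\in\mathbb{N}}$ and $(w_n)_{n\in\mathbb{N}}$ converge weakly to some $x\in\operatorname{Fix}T_{\overline{\gamma}}$, where $T_\gamma:=\mathrm{Id}-J_{\gamma A}+J_{\gamma B}R_{\gamma A}$ for $\gamma\in\mathbb{R}_{++}$, and $(z_n)_{n\in\mathbb{N}}$ and $(y_n)_{n\in\mathbb{N}}$ converge weakly to $J_{\overline{\gamma}A}x\in Z$.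
   Context: $\mathbb{R}_{++}$ is the set of positive real numbers, and $t_+=\max\{t,0\}$. For a set-valued operator $A\colon X\rightrightarrows X$, $\operatorname{zer}A=\{x\in X:0\in Ax\}$; $J_A=(\mathrm{Id}+A)^{-1}$ is the resolvent of $A$ and $R_A=2J_A-\mathrm{Id}$ its reflected resolvent. For maximally monotone $A$ and $\gamma>0$, $J_{\gamma A}$ is single-valued with full domain. $\operatorname{Fix}T=\{x: Tx=x\}$. *)

(* Defs.v *)
From mathcomp Require Import all_boot all_order all_algebra.
From mathcomp Require Import all_classical all_reals all_analysis.

Set Implicit Arguments.
Unset Strict Implicit.
Unset Printing Implicit Defensive.

Import Order.TTheory GRing.Theory Num.Theory.
Import numFieldNormedType.Exports.

Local Open Scope classical_set_scope.
Local Open Scope ring_scope.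

Section SetValuedOperators.
Context {R : realType} {X : lmodType R}.
Implicit Types (A B : X -> set X) (T : X -> X).

Definition add_op A B : X -> set X :=
  fun x => [set u + v | u in A x & v in B x].

Definition scale_op (g : R) A : X -> set X := fun x => [set g *: u | u in A x].

Definition inv_op A : X -> set X := fun u => [set x | A x u].

Definition id_op : X -> set X := fun x => [set x].

Definition zer A : set X := [set x | A x 0].

Definition Fix T : set X := [set x | T x = x].

(* The resolvent (Id + A)^-1 as a map of points: [xget 0 S] is an element of
   [S] when [S] is nonempty and 0 otherwise.  For maximally monotone [A] on a
   Hilbert space, [inv_op (add_op id_op A) x] is always a singleton (Minty), so
   that the default value 0 and the choice of an element play no role. *)
Definition resolvent A : X -> X :=
  fun x => xget 0 (inv_op (add_op id_op A) x).

Definition reflected_resolvent A : X -> X := fun x => 2 *: resolvent A x - x.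

Definition DR_op A B (g : R) : X -> X := fun x =>
  x - resolvent (scale_op g A) x
    + resolvent (scale_op g B) (reflected_resolvent (scale_op g A) x).

End SetValuedOperators.

Section Hilbert.
Context {R : realType} {X : completeNormedModType R}.
Variable inner : {dot X for idfun}.
Implicit Types A B : X -> set X.

(* A real Hilbert space is a complete normed module whose norm is induced by a
   symmetric positive definite bilinear form. *)
Definition hilbert_inner : Prop :=
  forall u : X, `|u| = Num.sqrt (inner u u).

Definition monotone_op A : Prop :=
  forall x u y v : X, A x u -> A y v -> 0 <= inner (x - y) (u - v).

Definition maximally_monotone A : Prop :=
  monotone_op A /\
  forall B, monotone_op B -> (forall x, A x `<=` B x) -> B = A.

Definition weakly_converges (u : nat -> X) (l : X) : Prop :=
  forall v : X, (fun n => inner (u n) v) @ \oo --> inner l v.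

End Hilbert.

(* Main.v *)
Require Import Defs.
From mathcomp Require Import all_boot all_order all_algebra.
From mathcomp Require Import all_classical all_reals all_analysis.
From mathcomp Require Import ring lra.

Set Implicit Arguments.
Unset Strict Implicit.
Unset Printing Implicit Defensive.

Import Order.TTheory GRing.Theory Num.Theory.
Import numFieldNormedType.Exports.

Local Open Scope classical_set_scope.
Local Open Scope ring_scope.

(** Write x_n = z_n + gam_n a_n with a_n in A z_n, and let b_n in B y_n be the
    element that the second resolvent selects.  The update of x_n is built so
    that x_(n+1) and w_n carry the same point (z_(n+1), a_(n+1)) of the graph of
    A, scaled by gam_(n+1) and by gam_n respectively.  The iteration is thus a
    Douglas-Rachford step x_n |-> w_n followed by a relocation w_n |-> x_(n+1)
    that moves the fixed points zs + gam_n us, where us is in A zs and - us in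
    B zs, onto the fixed points for the new parameter.

    The Douglas-Rachford step is firmly nonexpansive ([DR_step_le]), and the
    relocation increases the distance to zs + gam_n us by a factor at most
    max(1, gam_(n+1) / gam_n) ([relocation_le]).  Since the positive parts of
    the increments of gam are summable and gam is bounded away from 0, the product
    of these factors is dominated by a convergent weight p_n ([step_weights]).
    Dividing by p_n makes the squared distances nonincreasing, whence the
    distances converge and z_n - y_n, which is gam_n (a_n + b_n), tends to 0
    ([fejer_cvg]).

    Weak limits are taken along ultrafilters on nat that refine the filter at
    infinity: every bounded family has one, by the Riesz argument of
    [bounded_weak_ultra_cvg].  A limit (zl, al) of (z_n, a_n) satisfies
    al in A zl and - al in B zl because maximal monotonicity survives the
    passage to the limit as soon as z_n - y_n and a_n + b_n vanish strongly
    ([demiclosed_sum]).  Opial's argument with the moving centres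
    zs + gam_n us shows that two ultrafilters produce the same limit
    ([cluster_unique]), which upgrades convergence along ultrafilters to
    convergence of the sequences ([graph_weak_cvg]).

    All this presupposes that the resolvents are defined everywhere, which is
    the theorem of Minty ([minty]); it is obtained by minimizing the Fitzpatrick
    function of the operator plus half the squared norm.  This minimization and
    the Riesz argument both rest on one principle: minimizing sequences of a
    function with a quadratic midpoint gap are Cauchy
    ([minimizing_sequence_cvg]). *)

(** * Real inner products *)

Section InnerProduct.
Context {R : realType} {X : completeNormedModType R}.
Variable inner : {dot X for idfun}.
Local Notation "''[' u , v ]" := (inner u%R v%R) : ring_scope.
Implicit Types u v p q : X.

Lemma innerC u v : '[u, v] = '[v, u].
Proof. by rewrite hermC/= expr0 mul1r. Qed.

Lemma innerDl u v p : '[u + v, p] = '[u, p] + '[v, p].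
Proof. exact: linearDl. Qed.
Lemma innerDr p u v : '[p, u + v] = '[p, u] + '[p, v].
Proof. exact: linearDr. Qed.
Lemma innerNl u p : '[- u, p] = - '[u, p].
Proof. exact: linearNl. Qed.
Lemma innerNr p u : '[p, - u] = - '[p, u].
Proof. exact: linearNr. Qed.
Lemma innerZl (c : R) u p : '[c *: u, p] = c * '[u, p].
Proof. exact: linearZl_LR. Qed.
Lemma innerZr (c : R) p u : '[p, c *: u] = c * '[p, u].
Proof. exact: linearZr_LR. Qed.
Definition innerE := (innerDl, innerDr, innerNl, innerNr, innerZl, innerZr).

Hypothesis hX : hilbert_inner inner.

Lemma inner_ge0 u : 0 <= '[u, u].
Proof.
have [->|u0] := eqVneq u 0; first by rewrite linear0l.
exact/ltW/neq0_dnorm_gt0.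
Qed.

Lemma inner_eq0 u : '[u, u] = 0 -> u = 0.
Proof.
move=> uu; apply/eqP; apply: contraPT isT => u0.
have : 0 < inner u u by exact: neq0_dnorm_gt0.
by rewrite uu ltxx.
Qed.

Lemma sqr_norm u : `|u| ^+ 2 = '[u, u].
Proof. by rewrite hX sqr_sqrtr// inner_ge0. Qed.

(** A consequence of the triangle inequality for the norm, by expanding the
    square of |u + v|. *)
Lemma inner_le u v : '[u, v] <= `|u| * `|v|.
Proof.
have : `|u + v| ^+ 2 <= (`|u| + `|v|) ^+ 2.
  by rewrite ler_sqr ?nnegrE ?addr_ge0// ler_normD.
rewrite sqr_norm sqrrD !sqr_norm !innerE (innerC v u); lra.
Qed.

Lemma norm_inner_le u v : `|'[u, v]| <= `|u| * `|v|.
Proof.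
rewrite ler_norml inner_le andbT lerNl -innerNl -(normrN u); exact: inner_le.
Qed.

Lemma cvg_inner (I : Type) (F : set_system I) {FF : Filter F}
    (f g : I -> X) (u v : X) :
  f @ F --> u -> g @ F --> v -> '[f i, g i] @[i --> F] --> '[u, v].
Proof.
move=> fu gv; apply/subr_cvg0.
have bound i : `|'[f i, g i] - '[u, v]| <=
    `|f i - u| * `|g i - v| + `|f i - u| * `|v| + `|u| * `|g i - v|.
  have -> : '[f i, g i] - '[u, v] =
      '[f i - u, g i - v] + '[f i - u, v] + '[u, g i - v].
    by rewrite !innerE; ring.
  apply: (le_trans (ler_normD _ _)); apply: lerD; last exact: norm_inner_le.
  by apply: (le_trans (ler_normD _ _)); apply: lerD; exact: norm_inner_le.
have f0 : `|f i - u| @[i --> F] --> 0 by apply/norm_cvg0P/subr_cvg0.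
have g0 : `|g i - v| @[i --> F] --> 0 by apply/norm_cvg0P/subr_cvg0.
apply/norm_cvg0P; apply: (@squeeze_cvgr _ _ _ _ (fun=> 0) (fun i =>
  `|f i - u| * `|g i - v| + `|f i - u| * `|v| + `|u| * `|g i - v|)).
- by near=> i; rewrite normr_ge0 bound.
- exact: cvg_cst.
- have -> : 0 = 0 * 0 + 0 * `|v| + `|u| * 0 :> R.
    by rewrite !(mul0r, mulr0) !addr0.
  by apply: cvgD; [apply: cvgD; apply: cvgM|apply: cvgM] => //; exact: cvg_cst.
Unshelve. all: by end_near. Qed.

End InnerProduct.

(** * Minimization of functions with a quadratic midpoint gap *)

Section MidpointConvexMinimization.
Context {R : realType} {T : Type}.
Variable S : T -> set R.

Lemma minimizing_sequence (b : R) :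
  (exists p, S p !=set0) -> (forall p s, S p s -> b <= s) ->
  exists (m : R) (u : nat -> T) (s : nat -> R),
    [/\ forall p t, S p t -> m <= t, forall n, S (u n) (s n) & s @ \oo --> m].
Proof.
move=> [p0 [s0 Ss0]] Sb; pose V := [set s | exists p, S p s].
have infV : has_inf V by split; [exists s0, p0|exists b => s [p]; exact: Sb].
have lbm p t : S p t -> inf V <= t.
  by move=> Spt; apply: ge_inf; [case: infV|exists p].
have step (n : nat) : exists ps : T * R,
    S ps.1 ps.2 /\ ps.2 < inf V + harmonic n.
  have [s [p Sps] slt] := inf_adherent (harmonic_gt0 n) infV.
  by exists (p, s).
have [us usP] := choice step.
exists (inf V), (fun n => (us n).1), (fun n => (us n).2); split => //.
  by move=> n; case: (usP n).
apply: (@squeeze_cvgr _ _ _ _ (fun=> inf V) (fun n => inf V + harmonic n)).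
- near=> n; have [Sn sn] := usP n.
  by rewrite (lbm _ _ Sn)/= ltW.
- exact: cvg_cst.
- rewrite -[X in _ --> X]addr0; apply: cvgD; first exact: cvg_cst.
  exact: cvg_harmonic.
Unshelve. all: by end_near. Qed.

(** The midpoint of two almost minimal points cannot go below [m], so the
    quadratic gap bounds their distance.  The projection [pi] lets a function of
    several vector variables be treated one component at a time, and [S p] is
    the set of upper bounds of the value at [p], so that the value itself may be
    infinite. *)
Lemma minimizing_sequence_cvg (V : completeNormedModType R) (c m : R)
    (pi : T -> V) (u : nat -> T) (s : nat -> R) : 0 < c ->
  (forall p t, S p t -> m <= t) -> (forall n, S (u n) (s n)) -> s @ \oo --> m ->
  (forall p q t t', S p t -> S q t' ->
     exists r, S r ((t + t') / 2 - c * `|pi p - pi q| ^+ 2)) ->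
  cvg (pi (u n) @[n --> \oo]).
Proof.
move=> c0 lbm Su sm mid; apply: cauchy_cvg; apply: cauchy_exP => e e0.
have ce0 : 0 < c * e ^+ 2 by rewrite mulr_gt0// exprn_gt0.
have [N _ sN] : \forall n \near \oo, s n < m + c * e ^+ 2.
  by apply: cvgr_lt sm _ _; rewrite ltrDl.
exists (pi (u N)).
change (\forall n \near \oo, ball (pi (u N)) e (pi (u n))).
near=> n; rewrite -ball_normE/=.
have sn : s n < m + c * e ^+ 2 by apply: sN; near: n; exists N.
have sN' := sN N (leqnn N).
have [r Sr] := mid _ _ _ _ (Su N) (Su n).
have /= := lbm _ _ Sr.
move=> h; have : c * `|pi (u N) - pi (u n)| ^+ 2 < c * e ^+ 2 by lra.
by rewrite ltr_pM2l// ltr_sqr ?nnegrE// ltW.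
Unshelve. all: by end_near. Qed.

End MidpointConvexMinimization.

(** * Minty's surjectivity theorem *)

(** First-order optimality at the left end of a segment: the linear term
    dominates for small [s]. *)
Lemma ge0_of_quadratic (R : realFieldType) (k K : R) : 0 <= K ->
  (forall s, 0 < s <= 1 -> 0 <= s * k + s ^+ 2 * K) -> 0 <= k.
Proof.
move=> K0 h; rewrite leNgt; apply/negP => k0.
have d0 : 0 < 1 - k + K by lra.
have s0 : 0 < - k / (1 - k + K) by rewrite divr_gt0// oppr_gt0.
have := h (- k / (1 - k + K)).
rewrite s0 ler_pdivrMr// mul1r => /(_ ltac:(lra)).
(* At this s, in ]0, 1], one has s K < - k, so the quadratic is negative. *)
set s := - k / _ in s0 *.
have se : s * (1 - k + K) = - k by rewrite /s divfK// gt_eqF.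
have -> : s * k + s ^+ 2 * K = s * (k + s * K) by ring.
rewrite pmulr_rge0// => h2.
have : s * (1 - k) > 0 by rewrite mulr_gt0//; lra.
lra.
Qed.

Section Minty.
Context {R : realType} {X : completeNormedModType R}.
Variable inner : {dot X for idfun}.
Hypothesis hX : hilbert_inner inner.
Local Notation "''[' u , v ]" := (inner u%R v%R) : ring_scope.
Implicit Types (M A : X -> set X) (u v : X).

(** Maximality in its usable form: a pair that is monotonically related to the
    whole graph belongs to it. *)
Definition pairwise_maximal M := forall x u,
  (forall a b, M a b -> 0 <= '[x - a, u - b]) -> M x u.

(** Adjoining to [A] a pair monotonically related to its graph keeps it
    monotone, so maximality forces the pair to be in [A] already. *)
Lemma maximally_monotone_pairwise A :
  maximally_monotone inner A -> pairwise_maximal A.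
Proof.
move=> [mA maxA] x u xu.
pose B y := A y `|` [set v | y = x /\ v = u].
suff -> : A = B by right.
apply/esym/maxA; last by move=> y v; left.
move=> y v y' v' [Ayv|[-> ->]] [Ayv'|[-> ->]].
- exact: mA.
- by have := xu _ _ Ayv; rewrite !innerE; lra.
- exact: xu.
- by rewrite !subrr linear0l.
Qed.

(** The upper bounds of F(x, u) + (|x|^2 + |u|^2) / 2 at [p] = (x, u), where
    F(x, u) = sup over (a, b) in M of <x, b> + <a, u> - <a, b> is the Fitzpatrick
    function of [M]. *)
Definition fitzpatrick_upper M (p : X * X) : set R :=
  [set s | forall a b, M a b ->
     '[p.1, b] + '[a, p.2] - '[a, b] + ('[p.1, p.1] + '[p.2, p.2]) / 2 <= s].

(** This is F(x, u) >= <x, u>, which expresses maximality: either (x, u) is in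
    [M] and enters the supremum itself, or some (a, b) in [M] has
    <x - a, u - b> < 0, which makes its contribution exceed <x, u>. *)
Lemma fitzpatrick_ge M : pairwise_maximal M -> forall p s,
  fitzpatrick_upper M p s -> '[p.1 + p.2, p.1 + p.2] / 2 <= s.
Proof.
move=> maxM [x u] s/= ps.
have [Mxu|nMxu] := pselect (M x u).
  by have /= := ps _ _ Mxu; rewrite !innerE (innerC _ u x); lra.
apply: contrapT => ns; apply: nMxu; apply: maxM => a b Mab.
rewrite leNgt; apply/negP => lt0; apply: ns.
have /= := ps _ _ Mab; move: lt0; rewrite !innerE (innerC _ u x); lra.
Qed.

Lemma fitzpatrick_midpoint M (p q : X * X) s t :
  fitzpatrick_upper M p s -> fitzpatrick_upper M q t ->
  fitzpatrick_upper M (2^-1 *: (p.1 + q.1), 2^-1 *: (p.2 + q.2))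
    ((s + t) / 2 - 8^-1 * ('[p.1 - q.1, p.1 - q.1] + '[p.2 - q.2, p.2 - q.2])).
Proof.
move=> ps qt a b Mab /=; have := ps _ _ Mab; have := qt _ _ Mab.
rewrite !innerE (innerC _ q.1 p.1) (innerC _ q.2 p.2); lra.
Qed.

(** A minimizer (x0, u0) of the regularized Fitzpatrick function satisfies
    <a, b> + <x0, a> + <u0, b> >= F(x0, u0) + |x0|^2 + |u0|^2 on the graph, by
    comparison along the segments towards (a, b), where F(a, b) <= <a, b>.  With
    F(x0, u0) >= <x0, u0> this reads <a + u0, b + x0> >= |x0 + u0|^2.  Hence
    (- u0, - x0) is in [M] by maximality, and testing the inequality on that very
    pair gives u0 = - x0. *)
Lemma minty M : monotone_op inner M -> pairwise_maximal M ->
  exists x, M x (- x).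
Proof.
move=> mM maxM.
have [a0 [b0 Mab0]] : exists a b, M a b.
  apply: contrapT => h; apply: (h); exists 0, 0; apply: maxM => a b Mab.
  by exfalso; apply: h; exists a, b.
have [] := @minimizing_sequence _ _ (fitzpatrick_upper M) 0.
- exists (a0, b0), ('[a0, b0] + ('[a0, a0] + '[b0, b0]) / 2) => a b Mab /=.
  have := mM _ _ _ _ Mab0 Mab; rewrite !innerE; lra.
- move=> p s /(fitzpatrick_ge maxM); have := inner_ge0 inner (p.1 + p.2); lra.
move=> m [u [s [lbm Su sm]]].
have cv1 : cvg ((u n).1 @[n --> \oo]).
  apply: (@minimizing_sequence_cvg _ _ _ _ (8^-1) _ fst _ _ _ lbm Su sm) => //
    p q t t' Sp Sq.
  eexists=> a b /(fitzpatrick_midpoint Sp Sq) /le_trans; apply.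
  by rewrite (sqr_norm hX); have := inner_ge0 inner (p.2 - q.2); lra.
have cv2 : cvg ((u n).2 @[n --> \oo]).
  apply: (@minimizing_sequence_cvg _ _ _ _ (8^-1) _ snd _ _ _ lbm Su sm) => //
    p q t t' Sp Sq.
  eexists=> a b /(fitzpatrick_midpoint Sp Sq) /le_trans; apply.
  by rewrite (sqr_norm hX); have := inner_ge0 inner (p.1 - q.1); lra.
move: cv1 cv2 => /cvg_ex[/= x0 cv1] /cvg_ex[/= u0 cv2].
have Sm : fitzpatrick_upper M (x0, u0) m.
  move=> a b Mab; rewrite /=.
  have cvl : '[(u n).1, b] + '[a, (u n).2] - '[a, b] +
      ('[(u n).1, (u n).1] + '[(u n).2, (u n).2]) / 2 @[n --> \oo] -->
      '[x0, b] + '[a, u0] - '[a, b] + ('[x0, x0] + '[u0, u0]) / 2.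
    by repeat (first [exact: cvg_cst | apply: cvg_inner | apply: cvgD |
     apply: cvgN | apply: cvgM]).
  by apply: (ler_cvg_to cvl sm); apply: nearW => n; exact: Su.
have opt a b : M a b -> m + ('[x0, x0] + '[u0, u0]) / 2 <=
    '[a, b] + '[x0, a] + '[u0, b].
  move=> Mab; rewrite -subr_ge0.
  apply: (@ge0_of_quadratic _ _
    (('[a - x0, a - x0] + '[b - u0, b - u0]) / 2)).
    have := inner_ge0 inner (a - x0); have := inner_ge0 inner (b - u0); lra.
  move=> c /andP[c0 c1].
  (* By convexity of F, the Fitzpatrick function at the point of parameter c is
     at most (1 - c) F(x0, u0) + c <a, b>. *)
  have /lbm : fitzpatrick_upper M (x0 + c *: (a - x0), u0 + c *: (b - u0))
     ((1 - c) * (m - ('[x0, x0] + '[u0, u0]) / 2) + c * '[a, b] +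
       ('[x0 + c *: (a - x0), x0 + c *: (a - x0)] +
        '[u0 + c *: (b - u0), u0 + c *: (b - u0)]) / 2).
    move=> a' b' Mab'; apply: lerD => //=.
    have h1 : 0 <= (1 - c) * (m - ('[x0, x0] + '[u0, u0]) / 2 -
        ('[x0, b'] + '[a', u0] - '[a', b'])).
      by apply: mulr_ge0; [lra|have /= := Sm _ _ Mab'; lra].
    have h2 : 0 <= c * '[a - a', b - b'].
      by rewrite mulr_ge0 ?(ltW c0)//; exact: mM.
    move: h1 h2; rewrite !innerE; lra.
  rewrite !innerE (innerC _ a x0) (innerC _ b u0); lra.
have lb := fitzpatrick_ge maxM Sm.
have Mneg : M (- u0) (- x0).
  apply: maxM => a b Mab; have := opt _ _ Mab; move: lb.
  have := inner_ge0 inner (x0 + u0).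
  rewrite /= !innerE (innerC _ u0 x0) (innerC _ a x0) ; lra.
exists x0; have := opt _ _ Mneg; move: lb => /=.
rewrite !innerE (innerC _ u0 x0) => h1 h2.
have : x0 + u0 = 0.
  apply: (@inner_eq0 _ _ inner); apply/eqP; rewrite eq_le inner_ge0 andbT.
  by rewrite !innerE (innerC _ u0 x0); lra.
by move=> /eqP; rewrite addr_eq0 => /eqP e; rewrite {1}e.
Qed.

End Minty.

(** * Resolvents of maximally monotone operators *)

Section Resolvents.
Context {R : realType} {X : completeNormedModType R}.
Variable inner : {dot X for idfun}.
Hypothesis hX : hilbert_inner inner.
Local Notation "''[' u , v ]" := (inner u%R v%R) : ring_scope.
Implicit Types (A : X -> set X) (x z a : X) (g : R).

Lemma resolvent_graph A g z a : 0 < g ->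
  monotone_op inner A -> A z a -> resolvent (scale_op g A) (z + g *: a) = z.
Proof.
move=> g0 mA Aza; rewrite /resolvent; case: xgetP => [p _ /=|/(_ z)];
  last first.
  by case; exists z => //; exists (g *: a) => //; exists a.
case=> _ -> [_ [c Apc <-]] e.
have e2 : p - z = g *: (a - c).
  rewrite scalerBr -[p](addrK (g *: c)) e.
  by rewrite addrAC [z + _]addrC addrK.
have := mA _ _ _ _ Apc Aza.
rewrite e2 innerZl -(opprB a c) innerNr mulrN oppr_ge0.
rewrite pmulr_rle0// => le0; apply/eqP; rewrite -subr_eq0 e2.
have -> : a - c = 0.
  by apply: (@inner_eq0 _ _ inner); apply/eqP; rewrite eq_le inner_ge0 le0.
by rewrite scaler0.
Qed.

(** Minty's theorem for the operator z |-> g A z - x, whose graph is a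
    translate of a dilate of that of [A]. *)
Lemma resolventP A g x : maximally_monotone inner A -> 0 < g ->
  exists2 a, A (resolvent (scale_op g A) x) a &
    x = resolvent (scale_op g A) x + g *: a.
Proof.
move=> hA g0; have gn0 : g != 0 by rewrite gt_eqF.
have maxA := maximally_monotone_pairwise hA; have [mA _] := hA.
pose M p : set X := [set q | A p (g^-1 *: (x + q))].
have [] := @minty _ _ _ hX M.
- move=> p q p' q' /= Mpq Mpq'; have := mA _ _ _ _ Mpq Mpq'.
  rewrite -scalerBr opprD addrACA subrr add0r innerZr.
  by rewrite pmulr_rge0 ?invr_gt0.
- move=> p q Mpq; apply: maxA => a b Aab.
  have := Mpq a (g *: b - x); rewrite /M/= subrKC scalerA mulVf// scale1r.
  move=> /(_ Aab) h.
  rewrite -(pmulr_rge0 _ g0) -innerZr scalerBr scalerA mulfV// scale1r.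
  by move: h; rewrite opprB addrA [q + x]addrC.
move=> z; rewrite /M/= => Az.
have e : x = z + g *: (g^-1 *: (x - z)).
  by rewrite scalerA mulfV// scale1r subrKC.
have -> : resolvent (scale_op g A) x = z.
  by rewrite {1}e; exact: resolvent_graph.
by exists (g^-1 *: (x - z)).
Qed.

End Resolvents.

(** * Ultrafilters and weak limits *)

Section UltrafilterLimits.

(** If a neighbourhood [V] of [l] failed, the filter [F] could be restricted to
    the complement of its preimage and then refined to an ultrafilter. *)
Lemma cvg_ultraP (I : Type) (T : topologicalType) (F : set_system I)
    (f : I -> T) (l : T) : ProperFilter F ->
  (forall U, UltraFilter U -> F `<=` U -> f @ U --> l) -> f @ F --> l.
Proof.
move=> FF h V Vl; apply: contrapT => nFV.
have pG : ProperFilter (within (~` (f @^-1` V)) F).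
  split; last exact: within_filter.
  by rewrite /within /= => F0; apply: nFV; apply: filterS F0 => i /contrapT.
have [U [UU GU]] := ultraFilterLemma pG.
have FU : F `<=` U by move=> S FS; apply: GU; apply: filterS FS.
have UV : U (f @^-1` V) by exact: (h U UU FU).
have UnV : U (~` (f @^-1` V)) 
  by apply: GU; rewrite /within /=; apply: filterS filterT => i _.
have U0 : U set0 by rewrite -(setICr (f @^-1` V)); exact: filterI.
exact: filter_not_empty U0.
Qed.

Lemma bounded_ultra_cvg (R : realType) (I : Type) (U : set_system I)
    (f : I -> R) (M : R) : UltraFilter U -> (forall i, `|f i| <= M) ->
  exists l : R, f @ U --> l.
Proof.
move=> UU fM.
have [] := @segment_compact R (- M) M (f @ U) _ _.
  by apply: (@filterE _ U) => i /=; rewrite in_itv/= -ler_norml.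
move=> l [_ cl]; exists l => V Vl.
have [//|UnV] := in_ultra_setVsetC (f @^-1` V) UU.
have [] := cl (~` V) V UnV Vl.
by move=> r [].
Qed.

End UltrafilterLimits.

Section WeakLimits.
Context {R : realType} {X : completeNormedModType R}.
Variable inner : {dot X for idfun}.
Hypothesis hX : hilbert_inner inner.
Local Notation "''[' u , v ]" := (inner u%R v%R) : ring_scope.

Definition weak_cvg {I : Type} (F : set_system I) (u : I -> X) (l : X) :=
  forall v, '[u i, v] @[i --> F] --> '[l, v].

(** Along [U] the functionals <u_i, .> converge pointwise to a bounded linear
    functional [L]; the minimizer of |c|^2 / 2 - L c represents it. *)
Lemma bounded_weak_ultra_cvg (I : Type) (U : set_system I) (u : I -> X)
    (M : R) :
  UltraFilter U -> (forall i, `|u i| <= M) -> exists l, weak_cvg U u l.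
Proof.
move=> UU uM.
have uvM v i : `|'[u i, v]| <= M * `|v|.
  by apply: (le_trans (norm_inner_le hX _ _)); rewrite ler_wpM2r.
have [L Lcvg] := choice (fun v => bounded_ultra_cvg UU (uvM v)).
have LM v : `|L v| <= M * `|v|.
  apply: (closed_cvg _ (@closed_le R (M * `|v|)) _ _ (cvg_norm (Lcvg v))).
  by apply: nearW => i; exact: uvM.
have LD v v' : L (v + v') = L v + L v'.
  apply: (@cvg_unique _ _ _ _ _ _ (Lcvg _)) => //.
  have -> : (fun i => '[u i, v + v']) = (fun i => '[u i, v] + '[u i, v']).
    by apply/funext => i; rewrite innerDr.
  exact: cvgD.
have LZ c v : L (c *: v) = c * L v.
  apply: (@cvg_unique _ _ _ _ _ _ (Lcvg _)) => //.
  have -> : (fun i => '[u i, c *: v]) = (fun i => c * '[u i, v]).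
    by apply/funext => i; rewrite innerZr.
  by apply: cvgM => //; exact: cvg_cst.
have LN v : L (- v) = - L v by rewrite -scaleN1r LZ mulN1r.
pose S c : set R := [set s | '[c, c] / 2 - L c <= s].
have [] := @minimizing_sequence _ _ S (- M ^+ 2 / 2).
- by exists 0; exists ('[0, 0] / 2 - L 0); exact: lexx.
- move=> p s /=; apply: le_trans.
  have := LM p; rewrite ler_norml => /andP[_]; rewrite -(sqr_norm hX).
  have := sqr_ge0 (M - `|p|); rewrite sqrrB; lra.
move=> m [c [s [lbm Sc sm]]].
have : cvg (c n @[n --> \oo]).
  apply: (@minimizing_sequence_cvg _ _ _ _ (8^-1) _ idfun _ _ _ lbm Sc sm) => //
    p q t t' /= Sp Sq.
  exists (2^-1 *: (p + q)).
  rewrite /S/= LZ LD (sqr_norm hX) !innerE (innerC _ q p).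
  by move: Sp Sq; rewrite /S/=; lra.
move=> /cvg_ex[/= l cl].
have Lcl : L (c n) @[n --> \oo] --> L l.
  apply/subr_cvg0/norm_cvg0P.
  apply: (@squeeze_cvgr _ _ _ _ (fun=> 0) (fun n => M * `|c n - l|)).
  - by apply: nearW => n; rewrite normr_ge0 -LN -LD LM.
  - exact: cvg_cst.
  - rewrite -[X in _ --> X](mulr0 M); apply: cvgM; first exact: cvg_cst.
    by apply/norm_cvg0P/subr_cvg0.
have lm : '[l, l] / 2 - L l <= m.
  have cvl : '[c n, c n] / 2 - L (c n) @[n --> \oo] --> '[l, l] / 2 - L l.
    apply: cvgB => //; apply: cvgM; last exact: cvg_cst.
    exact: cvg_inner.
  by apply: (ler_cvg_to cvl sm); apply: nearW => n; exact: Sc.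
(* One inequality suffices, since both sides are odd in v. *)
have half v : 0 <= '[l, v] - L v.
  apply: (@ge0_of_quadratic _ _ ('[v, v] / 2)).
    by rewrite divr_ge0// inner_ge0.
  move=> t _; have := lbm (l + t *: v) _ (lexx _).
  rewrite LD LZ !innerE (innerC _ v l); lra.
exists l => v; suff -> : '[l, v] = L v by exact: Lcvg.
by have := half v; have := half (- v); rewrite LN innerNr; lra.
Qed.

(** The pairing is not jointly continuous for weak convergence; boundedness of
    one factor and strong convergence of the other are what makes it pass to
    the limit. *)
Lemma weak_strong_cvg (I : Type) (F : set_system I) {FF : Filter F}
    (u v : I -> X) (l k : X) (M : R) :
   (forall i, `|u i| <= M) -> weak_cvg F u l -> v @ F --> k ->
  '[u i, v i] @[i --> F] --> '[l, k].
Proof.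
move=> uM ul vk.
have -> : (fun i => '[u i, v i]) = (fun i => '[u i, v i - k] + '[u i, k]).
  by apply/funext => i; rewrite !innerE; ring.
rewrite -[X in _ --> X]add0r; apply: cvgD => //.
apply/norm_cvg0P.
apply: (@squeeze_cvgr _ _ _ _ (fun=> 0) (fun n => M * `|v n - k|)).
- apply: nearW => n; rewrite normr_ge0/=.
  by apply: (le_trans (norm_inner_le hX _ _)); rewrite ler_wpM2r.
- exact: cvg_cst.
- rewrite -[X in _ --> X](mulr0 M); apply: cvgM; first exact: cvg_cst.
  by apply/norm_cvg0P/subr_cvg0.
Qed.

Lemma strong_weak_cvg (I : Type) (F : set_system I) {FF : Filter F}
    (u : I -> X) (l : X) :
  u @ F --> l -> weak_cvg F u l.
Proof. by move=> ul v; apply: cvg_inner => //; exact: cvg_cst. Qed.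

Lemma weak_cvgD (I : Type) (F : set_system I) {FF : Filter F}
    (u v : I -> X) (l k : X) :
  weak_cvg F u l -> weak_cvg F v k ->
  weak_cvg F (fun i => u i + v i) (l + k).
Proof.
move=> ul vk p; rewrite innerDl.
under [X in X @ _]funext do rewrite innerDl.
exact: cvgD.
Qed.

Lemma weak_cvgZ (I : Type) (F : set_system I) {FF : Filter F}
    (g : I -> R) (u : I -> X) (c : R) (l : X) :
  g @ F --> c -> weak_cvg F u l ->
  weak_cvg F (fun i => g i *: u i) (c *: l).
Proof.
move=> gc ul p; rewrite innerZl.
under [X in X @ _]funext do rewrite innerZl.
exact: cvgM.
Qed.

Lemma weak_cvgN (I : Type) (F : set_system I) {FF : Filter F}
    (u : I -> X) (l : X) :
  weak_cvg F u l -> weak_cvg F (fun i => - u i) (- l).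
Proof.
move=> ul p; rewrite innerNl.
under [X in X @ _]funext do rewrite innerNl.
exact: cvgN.
Qed.

End WeakLimits.

(** * Step sizes *)

Lemma cvg_bound (R : realType) (f : nat -> R) (l : R) :
  f @ \oo --> l -> exists M, forall n, `|f n| <= M.
Proof.
move=> fl; have /cvg_seq_bounded : cvg (f @ \oo) by apply/cvg_ex; exists l.
by move=> /pinfty_ex_gt0[M _ fM]; exists M => n; exact: (fM n I).
Qed.

Section StepSizes.
Context {R : realType} {gam : nat -> R} {gbar : R}.
Hypothesis gam_gt0 : forall n, 0 < gam n.
Hypothesis gbar_gt0 : 0 < gbar.
Hypothesis gam_cvg : gam @ \oo --> gbar.
Hypothesis gam_sum :
  (\sum_(0 <= n <oo) (Num.max (gam n.+1 - gam n) 0)%:E < +oo)%E.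

Lemma step_inv_bound : exists2 M, 0 < M & forall n, (gam n)^-1 <= M.
Proof.
have [M hM] := cvg_bound (cvgV (lt0r_neq0 gbar_gt0) gam_cvg).
have le n : (gam n)^-1 <= M by apply: le_trans (hM n); rewrite ler_norm.
by exists M => //; apply: lt_le_trans (le 0%N); rewrite invr_gt0.
Qed.

(** With sig_n the sum of the positive increments before step n and M a bound
    for the inverse step sizes, p_n = exp (M sig_n) works, because
    gam_(n+1) / gam_n <= 1 + M (gam_(n+1) - gam_n)_+ <= p_(n+1) / p_n. *)
Lemma step_weights : exists (p : nat -> R) (P : R),
  [/\ forall n, 1 <= p n <= P, forall n, p n <= p n.+1 &
      forall n, p n * gam n.+1 <= p n.+1 * gam n].
Proof.
have [M M0 gM] := step_inv_bound.
pose del n := Num.max (gam n.+1 - gam n) 0.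
have del0 n : 0 <= del n by rewrite le_max lexx orbT.
pose sig n := \sum_(0 <= k < n) del k.
have sig0 n : 0 <= sig n by apply: sumr_ge0.
have [C sigC] : exists C, forall n, sig n <= C.
  exists (fine (\sum_(0 <= n <oo) (del n)%:E)%E) => n.
  rewrite -lee_fin fineK; last first.
    rewrite ge0_fin_numE//; apply: nneseries_ge0 => k _ _.
    by rewrite lee_fin.
  rewrite -sumEFin; apply: nneseries_lim_ge => k _ _.
  by rewrite lee_fin.
have sigS n : sig n.+1 = sig n + del n by rewrite /sig big_nat_recr.
have pS n : expR (sig n.+1 * M) = expR (sig n * M) * expR (del n * M).
  by rewrite sigS mulrDl expRD.
have dM0 n : 0 <= del n * M by rewrite mulr_ge0// ltW.
exists (fun n => expR (sig n * M)), (expR (C * M)); split => n.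
- apply/andP; split; last by rewrite ler_expR ler_pM2r.
  by rewrite -expR0 ler_expR mulr_ge0// ltW.
- by rewrite pS ler_peMr ?expR_ge0// -expR0 ler_expR.
- rewrite pS -mulrA ler_pM2l ?expR_gt0//.
  apply: (@le_trans _ _ ((1 + del n * M) * gam n)); last first.
    by rewrite ler_pM2r// expR_ge1Dx.
  have h : 1 <= M * gam n by rewrite -ler_pdivrMr// mul1r.
  have h2 : gam n.+1 - gam n <= del n by rewrite le_max lexx.
  have : del n <= del n * (M * gam n) by rewrite ler_peMr.
  lra.
Qed.

End StepSizes.

(** * One-step estimates and demiclosedness *)

Section Estimates.
Context {R : realType} {X : completeNormedModType R}.
Variable inner : {dot X for idfun}.
Hypothesis hX : hilbert_inner inner.
Local Notation "''[' u , v ]" := (inner u%R v%R) : ring_scope.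

(** Moving from [u + g *: a] to [u + g' *: a] costs at most the factor
    r = p' / p, since g' <= r g and 1 <= r bound each of the three terms of the
    expanded square; the cross term has the right sign by monotonicity. *)
Lemma relocation_le (u a : X) (g g' p p' : R) : 0 <= '[u, a] ->
  0 < g -> 0 < g' -> 0 < p -> p <= p' -> p * g' <= p' * g ->
  p ^+ 2 * `|u + g' *: a| ^+ 2 <= p' ^+ 2 * `|u + g *: a| ^+ 2.
Proof.
move=> ua g0 g'0 p0 pp' pg; rewrite !(sqr_norm hX) !innerE (innerC _ a u).
have p'0 : 0 < p' by exact: lt_le_trans pp'.
have h1 : 0 <= (p' ^+ 2 - p ^+ 2) * '[u, u].
  by rewrite mulr_ge0 ?inner_ge0// subr_ge0 ler_sqr ?nnegrE ?(ltW p0) ?(ltW p'0).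
have h2 : 0 <= ((p' * g) ^+ 2 - (p * g') ^+ 2) * '[a, a].
  by rewrite mulr_ge0 ?inner_ge0// subr_ge0 ler_sqr ?nnegrE// mulr_ge0// ltW.
have h3 : 0 <= (p' * (p' * g) - p * (p * g')) * '[u, a].
  rewrite mulr_ge0// subr_ge0; apply: ler_pM => //; try exact: ltW.
  by rewrite mulr_ge0// ltW.
move: h1 h2 h3; lra.
Qed.

(** With d = z - y, monotonicity of [B] and then of [A] gives
    <x - xs, d> >= |d|^2, where x = z + g a and xs = zs + g us; the conclusion is
    the expansion of |(x - xs) - d|^2. *)
Lemma DR_step_le (A B : X -> set X) (g : R) (z a y b zs us : X) : 0 < g ->
  monotone_op inner A -> monotone_op inner B ->
  A z a -> B y b -> A zs us -> B zs (- us) ->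
  y + g *: b = z - g *: a ->
  `|y + g *: a - (zs + g *: us)| ^+ 2 <=
    `|z + g *: a - (zs + g *: us)| ^+ 2 - `|z - y| ^+ 2.
Proof.
move=> g0 mA mB Aza Byb Azs Bzs e.
have hA := mA _ _ _ _ Aza Azs; have hB := mB _ _ _ _ Byb Bzs.
have gb : g *: b = (z - y) - g *: a by rewrite addrAC -e addrAC subrr add0r.
have {}hA : 0 <= g * '[z - zs, a - us] by rewrite mulr_ge0// ltW.
have {hB} : 0 <= g * '[y - zs, b - - us] by rewrite mulr_ge0// ltW.
rewrite -innerZr scalerBr gb scalerN opprK.
have -> : y + g *: a - (zs + g *: us) = (z + g *: a - (zs + g *: us)) - (z - y).
  by rewrite [RHS]addrAC [z + _ - (z - y)]addrAC subKr.
set d := z - y; have -> : y = z - d by rewrite /d subKr.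
move: hA; clearbody d; rewrite !(sqr_norm hX) !innerE => h1 h2.
have s1 := innerC inner d z; have s2 := innerC inner d a.
have s3 := innerC inner d zs; have s4 := innerC inner d us.
rewrite s1 s2 s3 s4 in h2 *; lra.
Qed.

Lemma sqr_norm_cvg0 (I : Type) (F : set_system I) {FF : Filter F}
    (f : I -> X) :
  `|f i| ^+ 2 @[i --> F] --> 0 -> f @ F --> (0 : X).
Proof.
move=> f0; apply/cvgr0Pnorm_lt => e e0.
have : \forall i \near F, `|f i| ^+ 2 < e ^+ 2.
  by apply: cvgr_lt f0 _ _; rewrite exprn_gt0.
by apply: filterS => i; rewrite ltr_sqr ?nnegrE ?(ltW e0).
Qed.

(** In the sum of the two monotonicity inequalities at (p, p') and (q, q') the
    products of weakly convergent factors combine into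
    <y_i, a_i + b_i> + <a_i, z_i - y_i>, which vanishes.  The limit is an inequality
    between a term depending on (p, p') and one depending on (q, q'); since by
    maximality neither term can stay positive, both are nonnegative. *)
Lemma demiclosed_sum (I : Type) (F : set_system I) {FF : ProperFilter F}
    (A B : X -> set X)
    (z a y b : I -> X) (zl al : X) (M : R) :
  maximally_monotone inner A -> maximally_monotone inner B ->
  (forall i, A (z i) (a i)) -> (forall i, B (y i) (b i)) ->
  (forall i, `|a i| <= M) -> (forall i, `|y i| <= M) ->
  weak_cvg inner F z zl -> weak_cvg inner F a al ->
  z i - y i @[i --> F] --> 0 -> a i + b i @[i --> F] --> 0 ->
  A zl al /\ B zl (- al).
Proof.
move=> hA hB Aza Byb aM yM zw aw d0 e0.
have [mA _] := hA; have [mB _] := hB.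
have maxA := maximally_monotone_pairwise hA.
have maxB := maximally_monotone_pairwise hB.
have yw : weak_cvg inner F y zl.
  have -> : y = (fun i => z i + - (z i - y i)).
    by apply/funext => i; rewrite subKr.
  rewrite -[zl]subr0; apply: weak_cvgD => //; apply: weak_cvgN.
  exact: (strong_weak_cvg hX d0).
have bw : weak_cvg inner F b (- al).
  have -> : b = (fun i => (a i + b i) + - a i).
    by apply/funext => i; rewrite addrAC subrr add0r.
  rewrite -[- al]add0r; apply: weak_cvgD; last exact: weak_cvgN.
  exact: (strong_weak_cvg hX e0).
have key p p' q q' : A p p' -> B q q' ->
    0 <= '[zl - p, al - p'] + '[zl - q, - al - q'].
  move=> Ap Bq.
  pose f i := '[y i, a i + b i] + '[a i, z i - y i] - '[z i, p'] - '[a i, p]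
    - '[y i, q'] - '[b i, q] + ('[p, p'] + '[q, q']).
  have cf : f @ F --> '[zl, 0] + '[al, 0] - '[zl, p'] - '[al, p]
      - '[zl, q'] - '[- al, q] + ('[p, p'] + '[q, q']).
    apply: cvgD; last exact: cvg_cst.
    do 4![apply: cvgB => //].
    by apply: cvgD;
      [exact: (weak_strong_cvg hX yM yw e0)|exact: (weak_strong_cvg hX aM aw d0)].
  have : 0 <= '[zl, 0] + '[al, 0] - '[zl, p'] - '[al, p]
      - '[zl, q'] - '[- al, q] + ('[p, p'] + '[q, q']).
    apply: (closed_cvg _ (@closed_ge R 0) _ _ cf); apply: nearW => i /=.
    have := mA _ _ _ _ (Aza i) Ap; have := mB _ _ _ _ (Byb i) Bq.
    rewrite /f !innerE (innerC _ q) (innerC _ p (a i)) (innerC _ (a i) (z i))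
      (innerC _ (a i) (y i)).
    lra.
  rewrite !linear0r !innerE (innerC _ p al) (innerC _ q al); lra.
(* Otherwise the A-term is negative for some (p, p'), so the B-term is always
   positive, putting (zl, - al) in B; but the B-term at (zl, - al) itself is 0. *)
have Al : A zl al.
  apply: contrapT => nA; apply: (nA); apply: maxA => p p' Ap.
  rewrite leNgt; apply/negP => lt0.
  have Bl : B zl (- al).
    by apply: maxB => q q' Bq; have := key _ _ _ _ Ap Bq; lra.
  have := key _ _ _ _ Ap Bl; rewrite !subrr linear0l; lra.
split=> //; apply: maxB => q q' Bq.
by have := key _ _ _ _ Al Bq; rewrite !subrr linear0l add0r.
Qed.

End Estimates.

(** * Convergence of the iteration on graphs *)

Section GraphIteration.
Context {R : realType} {X : completeNormedModType R}.
Variable inner : {dot X for idfun}.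
Hypothesis hX : hilbert_inner inner.
Local Notation "''[' u , v ]" := (inner u%R v%R) : ring_scope.

Lemma sqr_norm_bounded (v : nat -> X) (l : R) :
  `|v n| ^+ 2 @[n --> \oo] --> l -> exists M, forall n, `|v n| <= M.
Proof.
move=> /cvg_bound[M hM]; exists (1 + M) => n.
have := hM n; rewrite ger0_norm ?sqr_ge0// => h.
have := sqr_ge0 (`|v n| - 1); rewrite sqrrB1; have := normr_ge0 (v n); nra.
Qed.

Variables (A B : X -> set X).
Hypotheses (hA : maximally_monotone inner A) (hB : maximally_monotone inner B).
Variables (gam : nat -> R) (gbar : R).
Hypothesis gam_gt0 : forall n, 0 < gam n.
Hypothesis gbar_gt0 : 0 < gbar.
Hypothesis gam_cvg : gam @ \oo --> gbar.
Hypothesis gam_sum :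
  (\sum_(0 <= n <oo) (Num.max (gam n.+1 - gam n) 0)%:E < +oo)%E.
Variables (z a y b : nat -> X).
Hypothesis Aza : forall n, A (z n) (a n).
Hypothesis Byb : forall n, B (y n) (b n).
Hypothesis step1 : forall n, y n + gam n *: b n = z n - gam n *: a n.
Hypothesis step2 : forall n, z n.+1 + gam n *: a n.+1 = y n + gam n *: a n.

Section Fejer.
Variables (zs us : X).
Hypotheses (Azs : A zs us) (Bzs : B zs (- us)).

Let D (n : nat) : R := `|z n + gam n *: a n - (zs + gam n *: us)| ^+ 2.

Let split_gap n g : z n + g *: a n - (zs + g *: us) =
  (z n - zs) + g *: (a n - us).
Proof. by rewrite scalerBr opprD addrACA. Qed.

Let gap_mono n : 0 <= '[z n - zs, a n - us].
Proof. by have [mA _] := hA; exact: mA. Qed.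

(** The squared distances divided by p_n^2 decrease by at least
    |z_n - y_n|^2 / p_n^2 at each step. *)
Lemma fejer_cvg :
  (exists l : R, D @ \oo --> l) /\ `|z n - y n| ^+ 2 @[n --> \oo] --> (0 : R).
Proof.
have [p [P [p1P pS pg]]] := step_weights gam_gt0 gbar_gt0 gam_cvg gam_sum.
have p0 n : 0 < p n by have /andP[p1 _] := p1P n; lra.
pose E n := D n / p n ^+ 2.
have D0 n : 0 <= D n by exact: sqr_ge0.
have [mA _] := hA; have [mB _] := hB.
have ES n : E n.+1 <= E n - `|z n - y n| ^+ 2 / p n ^+ 2.
  have := relocation_le hX (gap_mono n.+1) (gam_gt0 n) (gam_gt0 n.+1)
    (p0 n) (pS n) (pg n).
  rewrite -!split_gap step2 -/(D n.+1).
  have := DR_step_le hX (gam_gt0 n) mA mB (Aza n) (Byb n) Azs Bzs (step1 n).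
  rewrite -/(D n) => h1 h2; rewrite /E -mulrBl ler_pdivrMr ?exprn_gt0//.
  rewrite mulrAC ler_pdivlMr ?exprn_gt0// mulrC.
  apply: (le_trans h2); rewrite mulrC ler_pM2r// exprn_gt0//.
have q0 n : 0 <= `|z n - y n| ^+ 2 / p n ^+ 2 by rewrite divr_ge0 ?sqr_ge0.
have /cvg_ex[l El] : cvgn E.
  apply: nonincreasing_is_cvgn.
    by apply/nonincreasing_seqP => n; apply: (le_trans (ES n)); rewrite gerBl.
  by exists 0 => _ [n _ <-]; rewrite divr_ge0 ?sqr_ge0.
have /cvg_ex[q pq] : cvgn p.
  apply: nondecreasing_is_cvgn; first exact/nondecreasing_seqP.
  by exists P => _ [n _ <-]; have /andP[] := p1P n.
split.
  exists (l * q ^+ 2).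
  have -> : D = (fun n => E n * p n ^+ 2).
    by apply/funext => n; rewrite divfK// gt_eqF// exprn_gt0.
  by apply: cvgM => //; exact: (cvgM pq pq).
apply: (@squeeze_cvgr _ _ _ _ (fun=> 0) (fun n => (E n - E n.+1) * P ^+ 2)).
- apply: nearW => n; rewrite sqr_ge0/=.
  have /andP[_ pP] := p1P n.
  have h : `|z n - y n| ^+ 2 / p n ^+ 2 <= E n - E n.+1 by have := ES n; lra.
  rewrite ler_pdivrMr ?exprn_gt0// in h; apply: (le_trans h).
  apply: ler_wpM2l; last first.
    have pn0 := ltW (p0 n); rewrite ler_sqr ?nnegrE//; exact: le_trans pP.
  by have := ES n; have := q0 n; lra.
- exact: cvg_cst.
- have -> : 0 = (l - l) * P ^+ 2 by rewrite subrr mul0r.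
  apply: cvgM; last exact: cvg_cst.
  by apply: cvgB => //; move: El; rewrite -(cvg_shiftS E).
Qed.

(** By monotonicity the squared distance dominates both |z_n - zs|^2 and
    gam_n^2 |a_n - us|^2. *)
Lemma orbit_bounded : exists M, forall n,
  [/\ `|z n| <= M, `|a n| <= M & `|y n| <= M].
Proof.
have [[l Dl] d0] := fejer_cvg.
have [K DK] := cvg_bound Dl; have [K' dK'] := sqr_norm_bounded d0.
have [N N0 gN] := step_inv_bound gam_gt0 gbar_gt0 gam_cvg.
have {}DK n : '[z n - zs, z n - zs] + gam n ^+ 2 * '[a n - us, a n - us] <= K.
  have := DK n; rewrite ger0_norm ?sqr_ge0//; apply: le_trans.
  rewrite /D split_gap; have := mulr_ge0 (ltW (gam_gt0 n)) (gap_mono n).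
  move: (z n - zs) (a n - us) => u v.
  by rewrite (sqr_norm hX) !innerE (innerC _ v u); lra.
have zK n : `|z n - zs| <= 1 + K.
  have := DK n; rewrite -!(sqr_norm hX) -exprMn => h.
  have := sqr_ge0 (`|z n - zs| - 1); rewrite sqrrB1.
  have := normr_ge0 (z n - zs).
  have := sqr_ge0 (gam n * `|a n - us|); nra.
have aK n : `|a n - us| <= N * (1 + K).
  have : gam n * `|a n - us| <= 1 + K.
    have := DK n; rewrite -!(sqr_norm hX) -exprMn => h.
    have := sqr_ge0 (gam n * `|a n - us| - 1); rewrite sqrrB1.
    have : 0 <= gam n * `|a n - us| by rewrite mulr_ge0// ltW.
    have := sqr_ge0 (`|z n - zs|); nra.
  rewrite -ler_pdivlMl// => /le_trans; apply.
  by rewrite ler_wpM2r// (le_trans _ (zK n)).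
exists (Num.max (1 + K + `|zs| + K') (N * (1 + K) + `|us|)) => n.
have zn : `|z n| <= 1 + K + `|zs|.
  by rewrite -[z n](subrK zs); apply: (le_trans (ler_normD _ _)); rewrite lerD.
split.
- rewrite le_max; apply/orP; left; rewrite (le_trans zn)// lerDl.
  exact: le_trans (dK' 0%N).
- rewrite le_max; apply/orP; right.
  by rewrite -[a n](subrK us); apply: (le_trans (ler_normD _ _)); rewrite lerD.
- rewrite le_max; apply/orP; left.
  rewrite -[y n](subKr (z n)); apply: (le_trans (ler_normB _ _)).
  by rewrite lerD.
Qed.

End Fejer.

(** Opial's argument.  The difference of the squared distances to
    z1 + gam_n a1 and z2 + gam_n a2 converges along the whole sequence and is
    affine in x_n.  Its limits along [F] and along [G], namely - |X2 - X1|^2 and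
    |X2 - X1|^2 with Xi = zi + gbar ai, must therefore agree; then X1 = X2, and
    zi is the resolvent of [A] at Xi. *)
Lemma cluster_unique (F G : set_system nat) {FF : ProperFilter F}
    {FG : ProperFilter G} (z1 a1 z2 a2 : X) :
  \oo `<=` F -> \oo `<=` G ->
  A z1 a1 -> B z1 (- a1) -> A z2 a2 -> B z2 (- a2) ->
  weak_cvg inner F z z1 -> weak_cvg inner F a a1 ->
  weak_cvg inner G z z2 -> weak_cvg inner G a a2 ->
  z1 = z2 /\ a1 = a2.
Proof.
move=> oF oG A1 B1 A2 B2 Fz Fa Gz Ga.
have [[l1 D1] _] := fejer_cvg A1 B1; have [[l2 D2] _] := fejer_cvg A2 B2.
have [M hM] := orbit_bounded A1 B1.
pose x n := z n + gam n *: a n.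
pose X1 n := z1 + gam n *: a1; pose X2 n := z2 + gam n *: a2.
have [Mg gM] := cvg_bound gam_cvg.
have xM n : `|x n| <= M + Mg * M.
  have [zM aM _] := hM n.
  apply: (le_trans (ler_normD _ _)); rewrite lerD// normrZ ler_pM//.
have X12 c d (H : set_system nat) : ProperFilter H -> \oo `<=` H ->
    weak_cvg inner H z c -> weak_cvg inner H a d ->
    l1 - l2 = '[z2 + gbar *: a2 - (z1 + gbar *: a1),
      2 *: (c + gbar *: d) - (z2 + gbar *: a2 + (z1 + gbar *: a1))].
  move=> FH oH Hz Ha.
  have gH : gam @ H --> gbar by move=> V /gam_cvg; exact: oH.
  have XH (p q : X) : p + gam n *: q @[n --> H] --> p + gbar *: q.
    by apply: cvgD; [exact: cvg_cst|apply: cvgZ => //; exact: cvg_cst].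
  have xH : weak_cvg inner H x (c + gbar *: d).
    by apply: weak_cvgD => //; exact: weak_cvgZ.
  have DH : `|x n - X1 n| ^+ 2 - `|x n - X2 n| ^+ 2 @[n --> H] --> l1 - l2.
    by apply: cvgB => V; [move/D1|move/D2]; exact: oH.
  apply: (@cvg_unique _ _ _ _ _ _ DH) => //.
  have -> : (fun n => `|x n - X1 n| ^+ 2 - `|x n - X2 n| ^+ 2) =
      (fun n => 2 * '[x n, X2 n - X1 n] - '[X2 n - X1 n, X2 n + X1 n]).
    apply/funext => n; move: (x n) (X1 n) (X2 n) => p q r.
    rewrite !(sqr_norm hX) !innerE (innerC _ q p) (innerC _ r p) (innerC _ q r).
    by ring.
  rewrite innerDr innerNr innerZr (innerC _ _ (c + _)).
  apply: cvgB.
    apply: cvgM; first exact: cvg_cst.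
    by apply: (weak_strong_cvg hX xM xH); apply: cvgB; exact: XH.
  by apply: cvg_inner => //; [apply: cvgB|apply: cvgD]; exact: XH.
have e : z1 + gbar *: a1 = z2 + gbar *: a2.
  apply/eqP; rewrite -subr_eq0; apply/eqP; apply: (@inner_eq0 _ _ inner).
  have := X12 _ _ _ FF oF Fz Fa; rewrite (X12 _ _ _ FG oG Gz Ga).
  move: (z1 + _) (z2 + _) => u v; rewrite !innerE (innerC _ v u); lra.
have [mA _] := hA.
have e2 : z1 = z2.
  by rewrite -(resolvent_graph gbar_gt0 mA A1) e
    (resolvent_graph gbar_gt0 mA A2).
split=> //; move: e; rewrite e2 => /addrI/(scalerI _) ->//.
by rewrite gt_eqF.
Qed.

Lemma graph_weak_cvg (zs us : X) : A zs us -> B zs (- us) ->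
  exists zl al, [/\ A zl al, B zl (- al), weak_cvg inner \oo z zl,
    weak_cvg inner \oo a al & z n - y n @[n --> \oo] --> (0 : X)].
Proof.
move=> As Bs; have [M hM] := orbit_bounded As Bs.
have [_ d2] := fejer_cvg As Bs.
have d0 : z n - y n @[n --> \oo] --> (0 : X) by exact: sqr_norm_cvg0.
have zM n : `|z n| <= M by have [] := hM n.
have aM n : `|a n| <= M by have [] := hM n.
have yM n : `|y n| <= M by have [] := hM n.
have e0 : a n + b n @[n --> \oo] --> (0 : X).
  have -> : (fun n => a n + b n) = (fun n => (gam n)^-1 *: (z n - y n)).
    apply/funext => n.
    have -> : z n - y n = gam n *: (a n + b n).
      have -> : z n = y n + gam n *: b n + gam n *: a n by rewrite step1 subrK.
      by rewrite addrC !addrA addNr add0r scalerDr addrC.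
    by rewrite scalerA mulVf ?scale1r// gt_eqF.
  rewrite -(scaler0 _ gbar^-1); apply: cvgZ => //.
  by apply: cvgV => //; rewrite gt_eqF.
have lim U : UltraFilter U -> \oo `<=` U -> exists zl al,
    [/\ A zl al, B zl (- al), weak_cvg inner U z zl & weak_cvg inner U a al].
  move=> UU oU.
  have [zl zw] := bounded_weak_ultra_cvg hX UU zM.
  have [al aw] := bounded_weak_ultra_cvg hX UU aM.
  exists zl, al.
  have dU : z n - y n @[n --> U] --> (0 : X) by move=> V /d0; exact: oU.
  have eU : a n + b n @[n --> U] --> (0 : X) by move=> V /e0; exact: oU.
  by have [] := demiclosed_sum hX hA hB Aza Byb aM yM zw aw dU eU.
have [U [UU oU]] := @ultraFilterLemma nat \oo _.
have [zl [al [Al Bl zw aw]]] := lim U UU oU.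
have all_lim V : UltraFilter V -> \oo `<=` V ->
    weak_cvg inner V z zl /\ weak_cvg inner V a al.
  move=> VV oV; have [z2 [a2 [A2 B2 zw2 aw2]]] := lim V VV oV.
  by have [-> ->] := cluster_unique oU oV Al Bl A2 B2 zw aw zw2 aw2.
exists zl, al; split=> // v; apply: cvg_ultraP => V VV oV.
- by have [+ _] := all_lim V VV oV; exact.
- by have [_ +] := all_lim V VV oV; exact.
Qed.

End GraphIteration.

(** * The relocated Douglas-Rachford iteration *)

Theorem corollary4p11 (R : realType) (X : completeNormedModType R)
  (inner : {dot X for idfun}) (hX : hilbert_inner inner)
  (Gam : set R) (hGam : Gam `<=` [set t | 0 < t])
  (A B : X -> set X)
  (hA : maximally_monotone inner A) (hB : maximally_monotone inner B)
  (hZ : zer (add_op A B) !=set0)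
  (gam : nat -> R) (gbar : R)
  (hgam : forall n, Gam (gam n)) (hgbar : Gam gbar)
  (hcvg : gam @ \oo --> gbar)
  (hsum : (\sum_(0 <= n <oo) (Num.max (gam n.+1 - gam n) 0)%:E < +oo)%E)
  (x0 : X) (x y z w : nat -> X)
  (hx0 : x 0%N = x0)
  (hz0 : z 0%N = resolvent (scale_op (gam 0%N) A) x0)
  (hy : forall n, y n = resolvent (scale_op (gam n) B) (2 *: z n - x n))
  (hw : forall n, w n = x n - z n + y n)
  (hz : forall n, z n.+1 = resolvent (scale_op (gam n) A) (w n))
  (hx : forall n, x n.+1 =
     (gam n.+1 / gam n) *: w n + (1 - gam n.+1 / gam n) *: z n.+1) :
  exists xbar : X,
    [/\ Fix (DR_op A B gbar) xbar,
        weakly_converges inner x xbar,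
        weakly_converges inner w xbar &
        let zbar := resolvent (scale_op gbar A) xbar in
        [/\ zer (add_op A B) zbar,
            weakly_converges inner z zbar &
            weakly_converges inner y zbar] ].
Proof.
have gam_gt0 n : 0 < gam n by exact/hGam/hgam.
have gbar_gt0 : 0 < gbar by exact/hGam/hgbar.
have gam_neq0 n : gam n != 0 by rewrite gt_eqF.
have [mA _] := hA; have [mB _] := hB.
pose a n := (gam n)^-1 *: (x n - z n).
pose b n := (gam n)^-1 *: (2 *: z n - x n - y n).
(* a n is the element of A (z n) behind the resolvent, b n that of B (y n). *)
have aE n (c : X) : x n = z n + gam n *: c -> a n = c.
  by move=> xE; rewrite /a xE addrC addKr scalerA mulVf ?scale1r.
have xE n : x n = z n + gam n *: a n.
  by rewrite scalerA mulfV// scale1r subrKC.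
have Anext n : A (z n.+1) (a n.+1) /\ w n = z n.+1 + gam n *: a n.+1.
  have [c Ac wc] := resolventP hX (w n) hA (gam_gt0 n).
  rewrite -hz in Ac wc; suff -> : a n.+1 = c by [].
  (* The affine combination defining x n.+1 is z n.+1 + gam n.+1 *: c. *)
  apply: aE; rewrite hx wc scalerDr scalerBl scale1r scalerA divfK//.
  by rewrite addrCA [_ + gam n.+1 *: c]addrC addrK.
have Aza n : A (z n) (a n).
  case: n => [|n]; last by have [] := Anext n.
  have [c Ac xc] := resolventP hX x0 hA (gam_gt0 0%N).
  by rewrite -hz0 in Ac xc; suff -> : a 0%N = c by []; apply: aE; rewrite hx0.
have Byb n : B (y n) (b n).
  have [c Bc yc] := resolventP hX (2 *: z n - x n) hB (gam_gt0 n).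
  rewrite -hy in Bc yc; suff -> : b n = c by [].
  by rewrite /b yc addrC addKr scalerA mulVf ?scale1r.
have step1 n : y n + gam n *: b n = z n - gam n *: a n.
  rewrite scalerA mulfV// scale1r subrKC {1}xE scaler_nat mulr2n opprD.
  by rewrite addrA addrK.
have wE n : w n = y n + gam n *: a n.
  by rewrite hw {1}xE [z n + _]addrC addrK addrC.
have step2 n : z n.+1 + gam n *: a n.+1 = y n + gam n *: a n.
  by rewrite -wE; have [_ ->] := Anext n.
have [zs [u Au [v Bv uv]]] := hZ.
have Bs : B zs (- u).
  suff <- : v = - u by [].
  by apply/eqP; rewrite -addr_eq0 addrC uv.
have [zl [al [Al Bl zw aw d0]]] :=
  graph_weak_cvg hX hA hB gam_gt0 gbar_gt0 hcvg hsum Aza Byb step1 step2 Au Bs.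
have JA : resolvent (scale_op gbar A) (zl + gbar *: al) = zl.
  exact: (resolvent_graph gbar_gt0 mA Al).
have JB : resolvent (scale_op gbar B) (zl - gbar *: al) = zl.
  by rewrite -scalerN; exact: (resolvent_graph gbar_gt0 mB Bl).
have yw : weak_cvg inner \oo y zl.
  have -> : y = (fun n => z n + - (z n - y n)).
    by apply/funext => n; rewrite subKr.
  rewrite -[zl]subr0; apply: weak_cvgD => //; apply: weak_cvgN.
  exact: (strong_weak_cvg hX d0).
have gaw : weak_cvg inner \oo (fun n => gam n *: a n) (gbar *: al).
  exact: weak_cvgZ.
exists (zl + gbar *: al); rewrite JA; split.
- rewrite /Fix/= /DR_op /reflected_resolvent JA.
  have -> : 2 *: zl - (zl + gbar *: al) = zl - gbar *: al.
    by rewrite scaler_nat mulr2n opprD addrA addrK.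
  by rewrite JB subrK.
- by rewrite (funext xE); exact: weak_cvgD.
- by rewrite (funext wE); exact: weak_cvgD.
- by split=> //; exists al => //; exists (- al) => //; rewrite subrr.
Qed.
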